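(* Let $\tau$ be a generic Euclidean triangle with triangle group $G_\tau=\langle r_1,r_2,r_3\rangle$ and rotation subgroup $H_\tau$ (see context). Then $H_\tau$ is a free metabelian group of rank 2 generated by the rotations $r_1r_2$ and $r_1r_3$; that is, $H_\tau$ is isomorphic to $F_2/[[F_2,F_2],[F_2,F_2]]$, where $F_2$ is the free group on two generators, with $r_1r_2$ and $r_1r_3$ corresponding to the images of a free basis of $F_2$. As a consequence, $G_\tau$ does not admit any finite presentation.
   Context: A Euclidean triangle $\tau=A_1A_2A_3$ has edges $e_i=A_jA_k$ of length $\ell_i>0$, $\{i,j,k\}=\{1,2,3\}$. It is generic if for some real $k>0$ the numbers $k\ell_1,k\ell_2,k\ell_3$ are algebraically independent over $\mathbb{Q}$. Let $r_i$ be the reflection of the plane across the line containing $e_i$ and $G_\tau=\langle r_1,r_2,r_3\rangle\subset \mathrm{E}(2)$, with products composed left to right ($(x)gh=((x)g)h$). The rotation subgroup is $H_\tau=G_\tau\cap \mathrm{SE}(2)$, the index-2 subgroup of orientation-preserving elements of $G_\tau$. *)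

(* Defs.v *)
From HB Require Import structures.
From mathcomp Require Import all_boot all_order all_algebra.
From mathcomp Require Import reals.
From mathcomp Require Import mpoly.

Set Implicit Arguments.
Unset Strict Implicit.
Unset Printing Implicit Defensive.

Import Order.TTheory GRing.Theory Num.Theory.
Local Open Scope ring_scope.

(* A word over the alphabet T: a letter (x, e) stands for x if e = false and
   for x^-1 if e = true.  The free group F(T) is the set of words modulo free
   reduction. *)
Definition word (T : Type) := seq (T * bool).

Definition winv (T : Type) (w : word T) : word T :=
  rev (map (fun l => (l.1, ~~ l.2)) w).

Definition wcomm (T : Type) (u v : word T) : word T :=
  winv u ++ winv v ++ u ++ v.

(* gen_sub S w : the free-group element represented by w lies in the subgroup
   of F(T) generated by the elements represented by the words in S.  (This is
   the smallest set of words containing S, the empty word, closed under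
   concatenation, formal inversion, and free equivalence, i.e. insertion and
   deletion of cancelling pairs x x^-1.) *)
Inductive gen_sub (T : Type) (S : word T -> Prop) : word T -> Prop :=
| gs_base w : S w -> gen_sub S w
| gs_nil : gen_sub S [::]
| gs_cat u v : gen_sub S u -> gen_sub S v -> gen_sub S (u ++ v)
| gs_inv u : gen_sub S u -> gen_sub S (winv u)
| gs_ins u v x e : gen_sub S (u ++ v) -> gen_sub S (u ++ (x, e) :: (x, ~~ e) :: v)
| gs_del u v x e : gen_sub S (u ++ (x, e) :: (x, ~~ e) :: v) -> gen_sub S (u ++ v).

Definition derived1 (T : Type) : word T -> Prop :=
  gen_sub (fun w => exists u v : word T, w = wcomm u v).

Definition derived2 (T : Type) : word T -> Prop :=
  gen_sub (fun w => exists u v : word T,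
             [/\ derived1 u, derived1 v & w = wcomm u v]).

Definition normal_closure (T : Type) (m : nat) (rels : 'I_m -> word T)
  : word T -> Prop :=
  gen_sub (fun w => exists (u : word T) (j : 'I_m), w = winv u ++ rels j ++ u).

Section Plane.
Variable R : realType.

Definition point := 'rV[R]_2.

(* An affine map of the plane, encoded as (A, b), acting on row vectors on the
   RIGHT:  (x) (A, b) = x *m A + b.  *)
Definition iso := ('M[R]_2 * 'rV[R]_2)%type.

Definition iso_act (g : iso) (x : point) : point := x *m g.1 + g.2.

Definition isE2 (g : iso) : Prop := g.1 *m g.1^T = 1%:M.
Definition isSE2 (g : iso) : Prop := isE2 g /\ \det g.1 = 1.

(* product composed left to right: (x)(g h) = ((x)g)h *)
Definition iso_mul (g h : iso) : iso := (g.1 *m h.1, g.2 *m h.1 + h.2).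
Definition iso_one : iso := (1%:M, 0).
(* inverse (valid for elements of E(2), where A^-1 = A^T) *)
Definition iso_inv (g : iso) : iso := (g.1^T, - (g.2 *m g.1^T)).

Inductive gen_iso (S : iso -> Prop) : iso -> Prop :=
| gi_base g : S g -> gen_iso S g
| gi_one : gen_iso S iso_one
| gi_mul g h : gen_iso S g -> gen_iso S h -> gen_iso S (iso_mul g h)
| gi_inv g : gen_iso S g -> gen_iso S (iso_inv g).

Fixpoint weval (T : Type) (f : T -> iso) (w : word T) : iso :=
  match w with
  | [::] => iso_one
  | l :: w' => iso_mul (if l.2 then iso_inv (f l.1) else f l.1) (weval f w')
  end.

Definition dot (u v : point) : R := (u *m v^T) 0 0.
Definition dist (P Q : point) : R := Num.sqrt (dot (P - Q) (P - Q)).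

(* reflection across the line through P and Q (P != Q):
   x |-> P + 2 ((x - P).d / d.d) d - (x - P), d = Q - P *)
Definition refl (P Q : point) : iso :=
  let d := Q - P in
  let A := (2 / dot d d) *: (d^T *m d) - 1%:M in
  (A, P - P *m A).

Definition noncollinear (A1 A2 A3 : point) : Prop :=
  \det (col_mx (A2 - A1) (A3 - A1)) != 0.

Definition alg_indep3 (x1 x2 x3 : R) : Prop :=
  forall p : {mpoly rat[3]}, p != 0 ->
    (map_mpoly (ratr : rat -> R) p).@[[ffun i : 'I_3 => [:: x1; x2; x3]`_i]] != 0.

Definition generic_lengths (l1 l2 l3 : R) : Prop :=
  exists k : R, 0 < k /\ alg_indep3 (k * l1) (k * l2) (k * l3).

Definition r1 (A1 A2 A3 : point) : iso := refl A2 A3.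
Definition r2 (A1 A2 A3 : point) : iso := refl A3 A1.
Definition r3 (A1 A2 A3 : point) : iso := refl A1 A2.

Definition G_tau (A1 A2 A3 : point) : iso -> Prop :=
  gen_iso (fun g => [\/ g = r1 A1 A2 A3, g = r2 A1 A2 A3 | g = r3 A1 A2 A3]).

Definition H_tau (A1 A2 A3 : point) : iso -> Prop :=
  fun g => G_tau A1 A2 A3 g /\ isSE2 g.

Definition finitely_presented (G : iso -> Prop) : Prop :=
  exists (n m : nat) (g : 'I_n -> iso) (rels : 'I_m -> word 'I_n),
    [/\ forall i, G (g i),
        forall h, G h -> exists w : word 'I_n, weval g w = h
      & forall w : word 'I_n, weval g w = iso_one <-> normal_closure rels w].

End Plane.

(* Main.v *)
Require Import Defs.
From HB Require Import structures.
From mathcomp Require Import all_boot all_order all_algebra.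
From mathcomp Require Import reals.
From mathcomp Require Import mpoly.
From mathcomp Require Import zify ring complex.
From Stdlib Require Import Setoid Morphisms.
Import Order.TTheory GRing.Theory Num.Theory.
Local Open Scope ring_scope.
Set Implicit Arguments.
Unset Strict Implicit.
Unset Printing Implicit Defensive.

(* In complex coordinates r1 r2 and r1 r3 are z |-> A3 + x (z - A3) and
   z |-> A2 + y (z - A2), so a word acts by a monomial x^m y^n and a translation
   which is (A2 - A3)(1 - y) times the Fox derivative of the word evaluated at
   (x, y).  Genericity makes x and y algebraically independent; hence a word
   acts trivially iff its exponent sums and its Fox derivative vanish.  Rewriting
   a word along the Schreier transversal a^m b^n turns the Fox derivative into
   the list of Schreier generators, which commute modulo F'', so this happens
   iff the word lies in F''.

   Independence: x = (p + D) / (p - D) and y = (q - D) / (q + D), where p, q are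
   polynomials in the lengths and D^2 is minus 16 times the squared area.  A
   relation between x and y reads A + D B = 0 with A, B in Q[l1, l2, l3]; D is
   purely imaginary, so A = B = 0 at a generic point and hence identically.
   Specialising the lengths to v(u^2 - 1), u(v^2 - 1), u^2 v^2 - 1 makes D^2 a
   square, x = u^2 and y = v^-2, so that the relation is trivial.

   If G were finitely presented, then any group generated by three involutions
   in which sufficiently many consequences of the relations of G hold would be a
   quotient of G.  For each M three involutions of Z x {three states} are given
   in which every word trivial in G acts trivially once M is large, while for
   every M some word trivial in G acts nontrivially. *)

(** * Subgroups of the free group *)

Section Words.
Context {T : Type}.
Implicit Types (u v w p q : word T) (S : word T -> Prop).

Lemma winv_cat u v : winv (u ++ v) = winv v ++ winv u.
Proof. by rewrite /winv map_cat rev_cat. Qed.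

Lemma winv_cons l u : winv (l :: u) = winv u ++ [:: (l.1, ~~ l.2)].
Proof. by rewrite -cat1s winv_cat. Qed.

Lemma winvK u : winv (winv u) = u.
Proof.
by elim: u => // -[x e] u IH; rewrite winv_cons winv_cat IH /winv /= negbK.
Qed.

(** Induction on [p]: the inner part of [p ++ winv p] cancels first and leaves one cancelling
    pair. *)
Lemma gen_sub_cancel S u p v :
  gen_sub S (u ++ p ++ winv p ++ v) <-> gen_sub S (u ++ v).
Proof.
elim: p u v => [|[x e] p IH] u v //=.
rewrite winv_cons /= -!catA /=.
have := IH (u ++ [:: (x, e)]) ((x, ~~ e) :: v); rewrite -!catA /= => ->.
by split; [apply: gs_del | apply: gs_ins].
Qed.

(* When [gen_sub S] is normal, this is equality in the quotient by it; the
   contextual form is a congruence for concatenation without that assumption. *)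
Definition weqmod S u v :=
  forall p q, gen_sub S (p ++ u ++ q) <-> gen_sub S (p ++ v ++ q).

#[export] Instance weqmod_equiv S : Equivalence (weqmod S).
Proof.
split=> [u p q|u v H p q|u v w H1 H2 p q] //; first by symmetry; apply: H.
by rewrite (H1 p q).
Qed.

Lemma weqmod_refl S u : weqmod S u u.
Proof. by []. Qed.
#[local] Hint Resolve weqmod_refl : core.

#[export] Instance weqmod_cat S :
  Proper (weqmod S ==> weqmod S ==> weqmod S) (@cat (T * bool)).
Proof.
move=> u u' Hu v v' Hv p q; rewrite -!catA (Hu p (v ++ q)).
by have := Hv (p ++ u') q; rewrite -!catA.
Qed.

Lemma weqmodP S u : weqmod S u [::] -> gen_sub S u.
Proof. by move=> /(_ [::] [::]); rewrite /= cats0 => ->; apply: gs_nil. Qed.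

Lemma weqmod_catV S u : weqmod S (u ++ winv u) [::].
Proof. by move=> p q; rewrite -catA gen_sub_cancel. Qed.

Lemma weqmod_Vcat S u : weqmod S (winv u ++ u) [::].
Proof. by rewrite -[X in _ ++ X]winvK; apply: weqmod_catV. Qed.

Lemma weqmod_catVK S u v : weqmod S (u ++ winv u ++ v) v.
Proof. by rewrite catA weqmod_catV. Qed.

Lemma weqmod_VcatK S u v : weqmod S (winv u ++ u ++ v) v.
Proof. by rewrite catA weqmod_Vcat. Qed.

Definition normalw S := forall w p, gen_sub S w -> gen_sub S (winv p ++ w ++ p).

Lemma gen_sub_eqmod S u v : weqmod S u v -> gen_sub S u -> gen_sub S v.
Proof. by move=> /(_ [::] [::]); rewrite /= !cats0 => ->. Qed.

Lemma gen_sub_normal S :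
  (forall w p, S w -> gen_sub S (winv p ++ w ++ p)) -> normalw S.
Proof.
move=> HS w p; elim=> {w} [w Hw||u v _ Hu _ Hv|u _ Hu|u v x e _|u v x e _].
- exact: HS.
- by apply: weqmodP; apply: weqmod_Vcat.
- have := gs_cat Hu Hv; apply: gen_sub_eqmod.
  by rewrite -!catA (weqmod_catVK S p (v ++ p)).
- by have := gs_inv Hu; rewrite !winv_cat winvK -catA.
- by rewrite -!catA !(catA (winv p) u) /=; apply: gs_ins.
- by rewrite -!catA !(catA (winv p) u) /=; apply: gs_del.
Qed.

(** In context p u q = (p u p^-1)(p q), and the conjugate lies in the normal subgroup. *)
Lemma weqmod_nil S u : normalw S -> gen_sub S u -> weqmod S u [::].
Proof.
move=> nS Su p q; rewrite /=.
have Sp e : gen_sub S (p ++ (if e then winv u else u) ++ winv p).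
  by rewrite -{1}[p]winvK; apply: nS; case: e => //; apply: gs_inv.
split=> H; first have := gs_cat (Sp true) H; last have := gs_cat (Sp false) H.
  apply: gen_sub_eqmod; rewrite -!catA.
  by rewrite (weqmod_VcatK S p (u ++ q)) weqmod_VcatK.
by apply: gen_sub_eqmod; rewrite -!catA (weqmod_VcatK S p q).
Qed.

Lemma wcomm_conj S u v p :
  weqmod S (winv p ++ wcomm u v ++ p)
          (wcomm (winv p ++ u ++ p) (winv p ++ v ++ p)).
Proof.
rewrite /wcomm !winv_cat !winvK -!catA.
rewrite (weqmod_catVK S p (winv v ++ _)) (weqmod_catVK S p (u ++ _)).
by rewrite (weqmod_catVK S p (v ++ _)).
Qed.

Lemma derived1_normal : normalw (fun w => exists u v, w = wcomm u v).
Proof.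
apply: gen_sub_normal => _ p [u [v ->]].
apply: gen_sub_eqmod (symmetry (wcomm_conj _ u v p)) _.
by apply: gs_base; eexists; eexists.
Qed.

Lemma derived2_normal :
  normalw (fun w => exists u v, [/\ derived1 u, derived1 v & w = wcomm u v]).
Proof.
apply: gen_sub_normal => _ p [u [v [Hu Hv ->]]].
apply: gen_sub_eqmod (symmetry (wcomm_conj _ u v p)) _.
apply: gs_base; exists (winv p ++ u ++ p), (winv p ++ v ++ p).
by split=> //; apply: derived1_normal.
Qed.

(** With the convention of [wcomm], v u [u, v] = u v. *)
Lemma weqmod_comm S u v :
  normalw S -> gen_sub S (wcomm u v) -> weqmod S (u ++ v) (v ++ u).
Proof.
move=> nS Suv; have Huv := weqmod_nil nS Suv.
have : weqmod S ((v ++ u) ++ wcomm u v) ((v ++ u) ++ [::]) by rewrite Huv.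
by rewrite cats0 /wcomm -!catA (weqmod_catVK S u (winv v ++ _)) weqmod_catVK.
Qed.

End Words.
#[export] Hint Resolve weqmod_refl : core.

(** * The free metabelian group of rank 2 *)

Section FreeMetabelian.
Implicit Types (u v w : word 'I_2) (p : int * int) (L : seq (int * int * bool)).

Notation derived1_base := (fun w => exists u v : word 'I_2, w = wcomm u v).
Notation derived2_base := (fun w => exists u v : word 'I_2,
                             [/\ derived1 u, derived1 v & w = wcomm u v]).

Definition expsum (i : 'I_2) (w : word 'I_2) : int :=
  \sum_(l <- w | l.1 == i) (-1) ^+ l.2.

Lemma expsum_cons i l w :
  expsum i (l :: w) = (if l.1 == i then (-1) ^+ l.2 else 0) + expsum i w.
Proof. by rewrite /expsum big_cons; case: eqP; rewrite ?add0r. Qed.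

Lemma expsum_cat i u v : expsum i (u ++ v) = expsum i u + expsum i v.
Proof. exact: big_cat. Qed.

Lemma expsum_inv i w : expsum i (winv w) = - expsum i w.
Proof.
elim: w => [|[x e] w IH]; first by rewrite /expsum big_nil oppr0.
rewrite winv_cons expsum_cat IH !expsum_cons /= /expsum big_nil addr0 opprD.
by rewrite addrC; congr (_ + _); case: ifP => _; rewrite ?oppr0 //; case: e.
Qed.

Lemma expsum_derived1 i w : derived1 w -> expsum i w = 0.
Proof.
elim=> {w} [_ [u [v ->]]||u v _ Hu _ Hv|u _ Hu|u v x e _|u v x e _].
- by rewrite /wcomm !expsum_cat !expsum_inv; lia.
- by rewrite /expsum big_nil.
- by rewrite expsum_cat Hu Hv.
- by rewrite expsum_inv Hu.
- rewrite !expsum_cat !expsum_cons /=; case: ifP => _; last by rewrite !add0r.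
  by move=> H; rewrite [X in _ + X]addrA; case: e; rewrite /= ?addrK ?addNr ?add0r.
- rewrite !expsum_cat !expsum_cons /=; case: ifP => _; last by rewrite !add0r.
  by rewrite [X in _ + X]addrA; case: e; rewrite /= ?addNr ?addrN ?add0r.
Qed.

Definition wpow (i : 'I_2) (m : int) : word 'I_2 := nseq `|m|%N (i, m < 0).

Lemma wpowS S i e m :
  weqmod S ((i, e) :: wpow i m) (wpow i (m + (-1) ^+ e)).
Proof.
have cancel b n : weqmod S ((i, ~~ b) :: nseq n.+1 (i, b)) (nseq n (i, b)).
  by have := weqmod_catVK S [:: (i, ~~ b)] (nseq n (i, b)); rewrite /winv /= negbK.
case: m => [[|n]|n]; case: e; rewrite ?(expr0, expr1) //.
- have -> : n.+1%:Z + -1 = n by lia.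
  exact: (cancel false).
- by have -> : n.+1%:Z + 1 = n.+2 by lia.
- by have -> : Negz n + -1 = Negz n.+1 by lia.
- case: n => [|n]; first exact: (cancel true 0%N).
  have -> : Negz n.+1 + 1 = Negz n by lia.
  exact: (cancel true n.+1).
Qed.

(* A Schreier transversal of F' in F, followed by its nontrivial Schreier
   generators (those of the second letter). *)
Definition wtrans p : word 'I_2 := wpow ord0 p.1 ++ wpow ord_max p.2.
Arguments wtrans : simpl never.

Definition wcell p : word 'I_2 :=
  winv (wtrans (p.1, p.2 + 1)) ++ (ord_max, false) :: wtrans p.

Lemma winv_wcell p :
  winv (wcell p) = winv (wtrans p) ++ (ord_max, true) :: wtrans (p.1, p.2 + 1).
Proof. by rewrite /wcell winv_cat winv_cons winvK -catA. Qed.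

Lemma wcell_derived1 p : derived1 (wcell p).
Proof.
have comm u v : weqmod derived1_base (u ++ v) (v ++ u).
  apply: weqmod_comm; first exact: derived1_normal.
  by apply: gs_base; exists u, v.
have cell : weqmod derived1_base ([:: (ord_max, false)] ++ wtrans p)
    (wtrans (p.1, p.2 + 1)).
  by rewrite /wtrans catA (comm [:: _]) -catA cat1s wpowS expr0.
by apply: weqmodP; rewrite /wcell -cat1s cell; apply: weqmod_Vcat.
Qed.

(* The Fox derivative with respect to the second generator, written as the list
   of its signed monomials; the derivation rule is the one for left-to-right
   products, so that each letter is weighted by the suffix that follows it. *)
Fixpoint fox w : seq (int * int * bool) :=
  if w is l :: w' then
    if l.1 == ord0 then fox w' else
    (expsum ord0 w', expsum ord_max w' - (l.2)%:Z, l.2) :: fox w'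
  else [::].

Definition wprod L : word 'I_2 :=
  flatten [seq if c.2 then winv (wcell c.1) else wcell c.1 | c <- L].

Lemma wprod_derived1 L : derived1 (wprod L).
Proof.
elim: L => [|[p e] L IH]; first exact: gs_nil.
apply: gs_cat IH; case: e => /=; last exact: wcell_derived1.
exact/gs_inv/wcell_derived1.
Qed.

Lemma ord2P (i : 'I_2) : i = ord0 \/ i = ord_max.
Proof. by case: i => -[|[|//]] H; [left|right]; apply: val_inj. Qed.

(** Letters are prepended one at a time. A first letter only changes m in a^m b^n, while b a^m b^n
    is a^m b^(n+1) times the cell at (m, n), and b^-1 a^m b^n is a^m b^(n-1) times the inverse cell
    at (m, n-1), hence the shift by [l.2] in [fox]. Only free cancellation occurs, so [S] is
    arbitrary. *)
Lemma weqmod_fox S w :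
  weqmod S w (wtrans (expsum ord0 w, expsum ord_max w) ++ wprod (fox w)).
Proof.
elim: w => [|[i e] w IH]; first by rewrite /expsum !big_nil.
rewrite -cat1s {1}IH !expsum_cons /=.
have [->|->] := ord2P i => /=.
  rewrite /wtrans /= add0r -cat_cons -cat_cons wpowS [_ + expsum _ _]addrC.
  reflexivity.
rewrite add0r [wprod (_ :: _)]/wprod /= -/(wprod _).
case: e => /=; last first.
  by rewrite subr0 /wcell -catA /= [_ + expsum _ _]addrC weqmod_catVK.
by rewrite winv_wcell /= subrK -catA /= [_ + expsum _ _]addrC weqmod_catVK.
Qed.

(** Vanishing of the Laurent polynomial whose signed monomials are listed in [L]. *)
Definition balanced L := forall p, count_mem (p, false) L = count_mem (p, true) L.

(** Cells lie in F', so they commute modulo F'': the head of the list is moved next to an opposite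
    occurrence and cancelled. *)
Lemma wprod_balanced L : balanced L -> derived2 (wprod L).
Proof.
move=> bL; apply: weqmodP; elim: {L}(size L).+1 {-2}L (ltnSn (size L)) bL => // n IH L.
case: L => [|[p e] L] //= szL bL.
have : (p, ~~ e) \in L.
  have := bL p; rewrite -has_pred1 has_count /= !xpair_eqE eqxx /=.
  by case: (e) => /=; lia.
move=> pL; case/splitPr: pL szL bL => L1 L2 szL bL.
have comm u v : derived1 u -> derived1 v -> weqmod derived2_base (u ++ v) (v ++ u).
  move=> Hu Hv; apply: weqmod_comm; first exact: derived2_normal.
  by apply: gs_base; exists u, v.
rewrite /wprod /= map_cat flatten_cat /= -!/(wprod _) catA.
have dC : derived1 (if e then winv (wcell p) else wcell p).
  by have := wprod_derived1 [:: (p, e)]; rewrite /wprod /= cats0.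
rewrite (comm _ _ dC (wprod_derived1 L1)).
rewrite -catA; have -> : (if ~~ e then winv (wcell p) else wcell p) =
    winv (if e then winv (wcell p) else wcell p) by case: (e); rewrite ?winvK.
rewrite weqmod_catVK.
have := IH (L1 ++ L2); rewrite /wprod map_cat flatten_cat; apply.
  by move: szL; rewrite !size_cat /=; lia.
move=> p'; have := bL p'; rewrite /= !count_cat /= !xpair_eqE.
by case: (p == p') => //=; case: (e) => /=; lia.
Qed.

Lemma derived2_fox w :
  expsum ord0 w = 0 -> expsum ord_max w = 0 -> balanced (fox w) -> derived2 w.
Proof.
move=> H0 H1 /wprod_balanced Hw; apply: (@gen_sub_eqmod _ derived2_base) Hw.
by rewrite [X in weqmod _ _ X]weqmod_fox H0 H1.
Qed.

End FreeMetabelian.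

(** * Algebraic independence of the rotation factors *)

Section Independence.
Variable R : realType.
Local Notation C := R[i].
Implicit Types (a b c d : C) (L : seq (int * int * bool)).

Definition ev a b c (p : {mpoly rat[3]}) : C :=
  (map_mpoly (ratr : rat -> C) p).@[fun i : 'I_3 => [:: a; b; c]`_i].

Lemma evD a b c p q : ev a b c (p + q) = ev a b c p + ev a b c q.
Proof. by rewrite /ev raddfD mevalD. Qed.

Lemma evM a b c p q : ev a b c (p * q) = ev a b c p * ev a b c q.
Proof. by rewrite /ev rmorphM mevalM. Qed.

Lemma ev0 a b c : ev a b c 0 = 0.
Proof. by rewrite /ev !raddf0. Qed.

Lemma evC a b c r : ev a b c r%:MP = ratr r.
Proof. by rewrite /ev map_mpolyC mevalC. Qed.

Lemma evX a b c i : ev a b c 'X_i = [:: a; b; c]`_i.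
Proof. by rewrite /ev map_mpolyX mevalXU. Qed.

Lemma ev_real (x y z : R) (p : {mpoly rat[3]}) :
  ev x%:C%C y%:C%C z%:C%C p =
  ((map_mpoly (ratr : rat -> R) p).@[[ffun i : 'I_3 => [:: x; y; z]`_i]])%:C%C.
Proof.
rewrite /ev; elim/mpolyind: p => [|r m p _ _ IH]; first by rewrite !raddf0.
have E (F : numFieldType) (v : 'I_3 -> F) :
    (map_mpoly (ratr : rat -> F) (r *: 'X_[m] + p)).@[v] =
    ratr r * \prod_(i < 3) v i ^+ m i + (map_mpoly (ratr : rat -> F) p).@[v].
  by rewrite raddfD mevalD /= map_mpolyZ map_mpolyX mevalZ mevalX.
rewrite [LHS]E (E R).
rewrite IH.
rewrite [RHS]rmorphD.
rewrite [X in _ = X + _]rmorphM.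
congr (_ * _ + _); first by rewrite -(fmorph_eq_rat (real_complex R \o ratr)).
rewrite rmorph_prod; apply: eq_bigr => -[i Hi] _; rewrite rmorphXn /= ffunE /=.
by case: i Hi => [|[|[|]]].
Qed.

(* Minus sixteen times the squared area, by Heron's formula. *)
Definition heron a b c : C := (c ^+ 2 - a ^+ 2 - b ^+ 2) ^+ 2 - 4 * a ^+ 2 * b ^+ 2.

(** Membership in Q[a, b, c] + d Q[a, b, c] with d^2 = [heron]. [A] and [B] do not depend on the
    point, so a relation at the generic point can be carried to any other. *)
Definition rep (phi : C -> C -> C -> C -> C) :=
  exists A B, forall a b c d, d ^+ 2 = heron a b c ->
    phi a b c d = ev a b c A + d * ev a b c B.

Lemma rep_ext phi psi :
  (forall a b c d, phi a b c d = psi a b c d) -> rep phi -> rep psi.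
Proof. by move=> E [A [B H]]; exists A, B => a b c d /H <-. Qed.

Lemma repC r : rep (fun _ _ _ _ => ratr r).
Proof.
by exists r%:MP, 0%:MP => a b c d _; rewrite !evC rmorph0 mulr0 addr0.
Qed.

Lemma rep1 : rep (fun _ _ _ _ => 1).
Proof. by apply: rep_ext (repC 1) => *; rewrite rmorph1. Qed.

Lemma rep_X i (Hi : (i < 3)%N) : rep (fun a b c _ => [:: a; b; c]`_i).
Proof.
by exists 'X_(Ordinal Hi), 0%:MP => a b c d _; rewrite evX evC rmorph0 mulr0 addr0.
Qed.

Lemma rep_d : rep (fun _ _ _ d => d).
Proof. by exists 0%:MP, 1%:MP => a b c d _; rewrite !evC rmorph0 rmorph1 add0r mulr1. Qed.

Lemma repD phi psi : rep phi -> rep psi ->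
  rep (fun a b c d => phi a b c d + psi a b c d).
Proof.
move=> [A [B H]] [A' [B' H']]; exists (A + A'), (B + B') => a b c d Hd.
by rewrite H // H' // !evD mulrDr addrACA.
Qed.

Lemma rep_heron_poly : exists D, forall a b c, ev a b c D = heron a b c.
Proof.
pose X (i : 'I_3) : {mpoly rat[3]} := 'X_i.
pose x := X (@Ordinal 3 0 isT); pose y := X (@Ordinal 3 1 isT).
pose z := X (@Ordinal 3 2 isT); pose m : {mpoly rat[3]} := (-1)%:MP.
pose s := z * z + m * (x * x) + m * (y * y).
exists (s * s + (- 4%:R)%:MP * (x * x * (y * y))) => a b c.
rewrite !(evD, evM, evC, evX) /= !rmorphN rmorph1 rmorph_nat /heron.
by ring.
Qed.

Lemma repM phi psi : rep phi -> rep psi ->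
  rep (fun a b c d => phi a b c d * psi a b c d).
Proof.
have [D HD] := rep_heron_poly.
move=> [A [B H]] [A' [B' H']]; exists (A * A' + D * (B * B')), (A * B' + A' * B).
move=> a b c d Hd; rewrite H // H' // !evD !evM HD -Hd {H H' HD Hd}.
move: (ev a b c A) (ev a b c B) (ev a b c A') (ev a b c B') => *.
by ring.
Qed.

Lemma repN phi : rep phi -> rep (fun a b c d => - phi a b c d).
Proof.
move=> H; apply: rep_ext (repM (repC (-1)) H) => a b c d.
by rewrite rmorphN rmorph1 mulN1r.
Qed.

Lemma repXn phi n : rep phi -> rep (fun a b c d => phi a b c d ^+ n).
Proof.
move=> H; elim: n => [|n IH]; first exact: rep1.
by apply: rep_ext (repM H IH) => *; rewrite exprS.
Qed.

Definition shift (N : nat) (m : int) : nat := `|(N%:Z + m)%R|%N.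

(** For exponents bounded by N this is the signed monomial in p / p' and q / q', cleared of
    denominators by (p p' q q')^N. *)
Definition term N (p p' q q' : C) (t : int * int * bool) : C :=
  (-1) ^+ t.2 * (p ^+ (shift N t.1.1) * p' ^+ (shift N (- t.1.1)%R))
              * (q ^+ (shift N t.1.2) * q' ^+ (shift N (- t.1.2)%R)).

Lemma rep_term N phi phi' psi psi' L :
  rep phi -> rep phi' -> rep psi -> rep psi' ->
  rep (fun a b c d => \sum_(t <- L)
    term N (phi a b c d) (phi' a b c d) (psi a b c d) (psi' a b c d) t).
Proof.
move=> H1 H2 H3 H4; elim: L => [|t L IH].
  by apply: rep_ext (repC 0) => *; rewrite big_nil rmorph0.
have Ht : rep (fun _ _ _ _ => (-1) ^+ t.2).
  by apply: rep_ext (repC ((-1) ^+ t.2)) => *; rewrite rmorphXn rmorphN rmorph1.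
have := repD (repM (repM Ht (repM (repXn (shift N t.1.1) H1) (repXn (shift N (- t.1.1)%R) H2)))
   (repM (repXn (shift N t.1.2) H3) (repXn (shift N (- t.1.2)%R) H4))) IH.
by apply: rep_ext => *; rewrite big_cons.
Qed.

(* By the law of cosines this is 2z when z is the product of an edge vector by
   the conjugate of another one, [a], [b], [c] are the lengths of these two edges
   and of the third one, and [d] is z minus its conjugate. *)
Definition cosl a b c d : C := c ^+ 2 - a ^+ 2 - b ^+ 2 + d.

Lemma rep_cosl : rep cosl.
Proof.
have X := fun i Hi => repXn 2 (@rep_X i Hi).
by have := repD (repD (repD (X 2%N isT) (repN (X 0%N isT))) (repN (X 1%N isT))) rep_d.
Qed.

Lemma rep_coslN : rep (fun a b c d => cosl a b c (- d)).
Proof.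
have X := fun i Hi => repXn 2 (@rep_X i Hi).
by have := repD (repD (repD (X 2%N isT) (repN (X 0%N isT))) (repN (X 1%N isT))) (repN rep_d).
Qed.

Lemma rep_cosl2 : rep (fun a b c d => cosl a c b d).
Proof.
have X := fun i Hi => repXn 2 (@rep_X i Hi).
by have := repD (repD (repD (X 1%N isT) (repN (X 0%N isT))) (repN (X 2%N isT))) rep_d.
Qed.

Lemma rep_cosl2N : rep (fun a b c d => cosl a c b (- d)).
Proof.
have X := fun i Hi => repXn 2 (@rep_X i Hi).
by have := repD (repD (repD (X 1%N isT) (repN (X 0%N isT))) (repN (X 2%N isT))) (repN rep_d).
Qed.

Definition bounded N L := all (fun t => (`|t.1.1| <= N)%N && (`|t.1.2| <= N)%N) L.

Lemma boundedP L : exists N, bounded N L.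
Proof.
elim: L => [|t L [N HN]]; first by exists 0%N.
exists (`|t.1.1| + `|t.1.2| + N)%N; rewrite /bounded /=; apply/andP; split; first lia.
by apply: sub_all HN => s /andP[H1 H2]; apply/andP; split; lia.
Qed.

(* Kronecker substitution: the second variable is the (2N+1)-th power of the
   first, so that distinct bounded exponents stay distinct. *)
Lemma balanced_of_roots N L : bounded N L ->
  (forall k : nat, (1 < k)%N ->
     \sum_(t <- L) ((-1) ^+ t.2 : C) * (k%:R ^+ 2) ^+ (shift N t.1.1)
        * ((k%:R ^+ (2 * N).+1) ^+ 2) ^+ (shift N (- t.1.2)%R) = 0) ->
  balanced L.
Proof.
move=> bL Hk.
pose K := (2 * N).+1.
pose e (p : int * int) := (shift N p.1 + K * shift N (- p.2)%R)%N.
pose P : {poly C} := \sum_(t <- L) (-1) ^+ t.2 *: 'X^(e t.1).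
have P0 : P = 0.
  apply/eqP; apply/negPn/negP => Pn0.
  (* These are [size P] distinct roots, more than the degree allows. *)
  pose s := [seq (k.+2%:R ^+ 2 : C) | k <- iota 0 (size P)].
  have := @max_poly_roots _ P s Pn0.
  rewrite size_map size_iota ltnn => H; apply/notF/H; last first.
    rewrite map_inj_uniq ?iota_uniq // => i j /eqP.
    rewrite -!natrX eqr_nat eqn_exp2r // => /eqP; lia.
  apply/allP => _ /mapP[k _ ->]; rewrite /root horner_sum.
  rewrite -{2}(Hk k.+2 isT); apply/eqP/eq_bigr => t _.
  by rewrite hornerZ hornerXn /e exprD [_ ^+ (K * _)]exprM [_ ^+ 2 ^+ K]exprAC mulrA.
move=> p; have [pL|pL] := boolP ((`|p.1| <= N)%N && (`|p.2| <= N)%N); last first.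
  have out (b0 : bool) : count_mem (p, b0) L = 0%N.
    apply/count_memPn; apply: contra pL => H; exact: (allP bL _ H).
  by rewrite !out.
(* Bounded exponents have shifts below K, so remainder and quotient by K recover them from [e]. *)
have ee (q : int * int) : (`|q.1| <= N)%N && (`|q.2| <= N)%N -> (e p == e q) = (q == p).
  move=> qN; apply/eqP/eqP => [|-> //]; case: p q pL qN => [p1 p2] [q1 q2] /andP/=[h1 h2] /andP/=[h3 h4].
  rewrite /e /K /= => E.
  suff [] : shift N (- p2)%R = shift N (- q2)%R /\ shift N p1 = shift N q1.
    by move=> E1 E2; congr (_, _); move: E1 E2; rewrite /shift; lia.
  have Ha : (shift N p1 < (2 * N).+1)%N by rewrite /shift; lia.
  have Hb : (shift N q1 < (2 * N).+1)%N by rewrite /shift; lia.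
  have E1 := congr1 (fun x => x %/ (2 * N).+1)%N E.
  have E2 := congr1 (fun x => x %% (2 * N).+1)%N E.
  move: E1 E2; rewrite /= ![(shift N _ + _)%N]addnC ![((2 * N).+1 * _)%N]mulnC.
  by rewrite !modnMDl !divnMDl // !(divn_small Ha, divn_small Hb, modn_small Ha, modn_small Hb) !addn0.
have := congr1 (fun Q : {poly C} => Q`_(e p)) P0.
rewrite /P coef_sum coef0.
have -> : \sum_(t <- L) ((-1) ^+ t.2 *: 'X^(e t.1) : {poly C})`_(e p) =
  (count_mem (p, false) L)%:R - (count_mem (p, true) L)%:R.
  elim: L bL {Hk P P0} => [|[q b] L IH] /=; first by rewrite big_nil subrr.
  move=> /andP[qN bL]; rewrite big_cons IH // coefZ coefXn /= !xpair_eqE.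
  rewrite ee //.
  case: (q == p); case: b => /=; rewrite ?mulr0 ?add0r ?add0n // !natrD ?expr0; ring.
by move/eqP; rewrite subr_eq0 eqr_nat => /eqP.
Qed.

(** The sum is A + d B with A, B real and d imaginary at this point, so both vanish there, hence
    identically by independence. The relation therefore also holds at the specialised lengths. *)
Lemma balanced_of_generic (x y z t : R) L N (d := (0 +i* t)%C) :
  alg_indep3 x y z -> t != 0 -> d ^+ 2 = heron x%:C%C y%:C%C z%:C%C ->
  bounded N L ->
  \sum_(s <- L) term N (cosl x%:C%C y%:C%C z%:C%C d) (cosl x%:C%C y%:C%C z%:C%C (- d))
     (cosl x%:C%C z%:C%C y%:C%C (- d)) (cosl x%:C%C z%:C%C y%:C%C d) s = 0 ->
  balanced L.
Proof.
move=> ind t0 Hd bL.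
have [A [B H]] := rep_term N L rep_cosl rep_coslN rep_cosl2N rep_cosl2.
rewrite H // !ev_real /d => /eqP; rewrite eq_complex /=.
rewrite !(mul0r, mulr0, subr0, addr0, add0r) mulf_eq0 (negPf t0) /= => /andP[A0 B0].
have zero p : (map_mpoly (ratr : rat -> R) p).@[[ffun i : 'I_3 => [:: x; y; z]`_i]] == 0 -> p = 0.
  by move=> /eqP p0; apply/eqP/negPn/negP => /ind; rewrite p0 eqxx.
move/zero: A0 H => ->; move/zero: B0 => -> H.
apply: (balanced_of_roots bL) => k k1.
(* By the law of sines, if u and v are the exponentials of i times the angles opposite [c] and [b],
   then [c], [b], [a] are proportional to u - 1/u, v - 1/v, uv - 1/(uv). The same formulas, times
   uv, are used at integers; v is the Kronecker power of u. *)
pose u : C := k%:R; pose v : C := k%:R ^+ (2 * N).+1.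
pose a : C := u ^+ 2 * v ^+ 2 - 1; pose b : C := u * (v ^+ 2 - 1).
pose c : C := v * (u ^+ 2 - 1); pose e : C := - a * (v ^+ 2 - 1) * (u ^+ 2 - 1).
have He : e ^+ 2 = heron a b c by rewrite /e /heron /a /b /c; ring.
have := H a b c e He; rewrite !ev0 mulr0 addr0.
pose f : C := - 2 * a * (v ^+ 2 - 1); pose g : C := - 2 * a * (u ^+ 2 - 1).
have -> : cosl a b c e = f * u ^+ 2 by rewrite /cosl /e /f /a /b /c; ring.
have -> : cosl a b c (- e) = f by rewrite /cosl /e /f /a /b /c; ring.
have -> : cosl a c b (- e) = g by rewrite /cosl /e /g /a /b /c; ring.
have -> : cosl a c b e = g * v ^+ 2 by rewrite /cosl /e /g /a /b /c; ring.
have k2 n : (0 < n)%N -> u ^+ n - 1 != 0.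
  move=> n0; rewrite subr_eq0 /u -natrX pnatr_eq1.
  by rewrite -[X in _ != X](exp1n n) eqn_exp2r // neq_ltn k1 orbT.
have u0 := k2 2%N isT.
have v0 : v ^+ 2 - 1 != 0 by rewrite /v -exprM; apply: k2.
have a0 : a != 0 by rewrite /a /v -exprM -exprD; apply: k2.
have f0 : f != 0 by rewrite /f !mulf_neq0 // oppr_eq0 pnatr_eq0.
have g0 : g != 0 by rewrite /g !mulf_neq0 // oppr_eq0 pnatr_eq0.
(* The two shifts of an exponent add up to 2N, so every term carries the factor f^(2N) g^(2N). *)
move=> S0; apply: (mulfI (mulf_neq0 (expf_neq0 (2 * N) f0) (expf_neq0 (2 * N) g0))).
rewrite mulr0 -[RHS]S0 mulr_sumr big_seq [RHS]big_seq /=; apply: eq_bigr => s sL.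
have /andP[s1 s2] := allP bL _ sL.
have E (h : C) m : (`|m| <= N)%N -> h ^+ (2 * N) = h ^+ shift N m * h ^+ shift N (- m)%R.
  by move=> mN; rewrite -exprD; congr (_ ^+ _); rewrite /shift; lia.
rewrite (E f s.1.1 s1) (E g s.1.2 s2) /term [(f * _) ^+ _]exprMn [(g * _) ^+ _]exprMn -/v -/u.
move: (f ^+ _) (f ^+ _) (g ^+ _) (g ^+ _) (u ^+ 2 ^+ _) (v ^+ 2 ^+ _) ((-1) ^+ _).
by move=> *; ring.
Qed.

Definition laurent L (x y : C) : C :=
  \sum_(t <- L) (-1) ^+ t.2 * x ^ t.1.1 * y ^ t.1.2.

Lemma laurent_term N L p p' q q' : bounded N L ->
  p != 0 -> p' != 0 -> q != 0 -> q' != 0 ->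
  \sum_(t <- L) term N p p' q q' t =
  (p * p' * q * q') ^+ N * laurent L (p / p') (q / q').
Proof.
move=> bL p0 p'0 q0 q'0; rewrite /laurent mulr_sumr big_seq [RHS]big_seq /=.
apply: eq_bigr => t tL; have /andP[t1 t2] := allP bL _ tL.
have hom (r r' : C) (m : int) : r != 0 -> r' != 0 -> (`|m| <= N)%N ->
    r ^+ (shift N m) * r' ^+ (shift N (- m)%R) = (r * r') ^+ N * (r / r') ^ m.
  have shiftE (h : C) (k : int) : h != 0 -> (`|k| <= N)%N -> h ^+ shift N k = h ^+ N * h ^ k.
    move=> h0 kN; rewrite exprnP; have -> : (shift N k)%:Z = N%:Z + k by rewrite /shift; lia.
    by rewrite expfzDr.
  move=> r0 r'0 mN; rewrite !shiftE //; last by rewrite abszN.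
  by rewrite exprzMl ?unitfE ?invr_eq0 // exprz_inv exprMn mulrACA.
rewrite /term !hom //.
rewrite (_ : p * p' * q * q' = (p * p') * (q * q')); last by ring.
rewrite [in RHS]exprMn.
move: ((p * p') ^+ N) ((q * q') ^+ N) ((p / p') ^ _) ((q / q') ^ _) ((-1) ^+ _).
by move=> *; ring.
Qed.

End Independence.

(** * Actions of words and plane isometries *)

(** Words act from left to right, like products of isometries. The inverse maps [fi] are a separate
    argument, so words can act on any type. *)
Definition act (T X : Type) (f fi : T -> X -> X) (w : word T) (x : X) : X :=
  foldl (fun y l => (if l.2 then fi else f) l.1 y) x w.

Definition wsubst (T U : Type) (h : T -> word U) (w : word T) : word U :=
  flatten [seq if l.2 then winv (h l.1) else h l.1 | l <- w].

Section Action.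
Variables (T X : Type) (f fi : T -> X -> X).
Implicit Types (u v w : word T) (x : X).

Lemma act_cat u v x : act f fi (u ++ v) x = act f fi v (act f fi u x).
Proof. exact: foldl_cat. Qed.

Lemma act_ext g gi w : f =2 g -> fi =2 gi -> act f fi w =1 act g gi w.
Proof. by move=> E Ei; elim: w => // -[t []] w IH x /=; rewrite ?E ?Ei. Qed.

Lemma act_morph (Y : Type) (g gi : T -> Y -> Y) (h : X -> Y) w x :
  (forall t y, h (f t y) = g t (h y)) -> (forall t y, h (fi t y) = gi t (h y)) ->
  h (act f fi w x) = act g gi w (h x).
Proof.
by move=> E Ei; elim: w x => // -[t e] w IH x /=; rewrite IH; case: e; rewrite ?E ?Ei.
Qed.

Lemma act_subst (U : Type) (h : U -> word T) (w : word U) x :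
  act f fi (wsubst h w) x =
  act (fun t => act f fi (h t)) (fun t => act f fi (winv (h t))) w x.
Proof.
elim: w x => // -[t e] w IH x; rewrite /wsubst /= act_cat IH.
by case: e.
Qed.

Hypotheses (fK : forall t, cancel (f t) (fi t)) (fiK : forall t, cancel (fi t) (f t)).

Lemma actK w : cancel (act f fi w) (act f fi (winv w)).
Proof.
elim: w => // -[t e] w IH x; rewrite winv_cons act_cat /= IH.
by case: e => /=; rewrite ?fK ?fiK.
Qed.

Lemma actVK w : cancel (act f fi (winv w)) (act f fi w).
Proof. by move=> x; rewrite -{1}[w]winvK actK. Qed.

Lemma act_gen_sub (S : word T -> Prop) w :
  (forall u, S u -> act f fi u =1 id) -> gen_sub S w -> act f fi w =1 id.
Proof.
move=> HS; elim=> {w} [w /HS //||u v _ Hu _ Hv|u _ Hu|u v t e _ H|u v t e _ H] x //.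
- by rewrite act_cat Hu Hv.
- by rewrite -{1}[x](Hu x) actK.
- by rewrite -{2}[x]H !act_cat /=; case: (e); rewrite /= ?fK ?fiK.
- by rewrite -{2}[x]H !act_cat /=; case: (e); rewrite /= ?fK ?fiK.
Qed.

End Action.

Definition pairw (i : 'I_2) : word 'I_3 := [:: (ord0, false); (lift ord0 i, false)].

(* Only the relations r_k^2 = 1 are used, hence the arbitrary action. *)
Lemma even_form (w : word 'I_3) : exists (u : word 'I_2) (b : bool),
  forall (X : Type) (s : 'I_3 -> X -> X), (forall k, involutive (s k)) ->
  act s s w =1 act s s (wsubst pairw u ++ nseq b (ord0, false)).
Proof.
elim/last_ind: w => [|w [k e] [u [b IH]]]; first by exists [::], false.
have sub_rcons v l : wsubst pairw (rcons v l) = wsubst pairw v ++ wsubst pairw [:: l].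
  by rewrite /wsubst map_rcons -cats1 flatten_cat.
have [i ->|->] := unliftP ord0 k; last first.
  exists u, (~~ b) => X s sK x; rewrite -cats1 act_cat IH // !act_cat /=.
  by case: b {IH} => /=; rewrite if_same ?sK.
(* A new s_k completes a pending s_0 to the pair s_0 s_k; with none pending it equals (s_0 s_k)^-1
   s_0. *)
exists (rcons u (i, ~~ b)), (~~ b) => X s sK x.
rewrite -cats1 act_cat IH // sub_rcons !act_cat /= if_same.
by case: b {IH} => /=; rewrite ?sK.
Qed.

Section Isometries.
Variable R : realType.
Implicit Types (g h : iso R) (x P Q : point R).

Lemma iso_act_mul g h x : iso_act (iso_mul g h) x = iso_act h (iso_act g x).
Proof. by rewrite /iso_act /= mulmxDl mulmxA addrA. Qed.

Lemma iso_act_one x : iso_act (iso_one R) x = x.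
Proof. by rewrite /iso_act /= mulmx1 addr0. Qed.

Lemma iso_act_inj g h : iso_act g =1 iso_act h -> g = h.
Proof.
case: g h => [A b] [B c] E.
have bc : b = c by have := E 0; rewrite /iso_act /= !mul0mx !add0r.
congr (_, _) => //; apply/row_matrixP => i; rewrite !rowE.
by have := E (delta_mx 0 i); rewrite /iso_act /= bc => /addIr.
Qed.

Lemma iso_act_weval (T : Type) (f : T -> iso R) w x :
  iso_act (weval f w) x =
  act (fun t => iso_act (f t)) (fun t => iso_act (iso_inv (f t))) w x.
Proof.
elim: w x => [|[t e] w IH] x /=; first exact: iso_act_one.
by rewrite iso_act_mul IH; case: e.
Qed.

Lemma iso_invK g : isE2 g -> cancel (iso_act g) (iso_act (iso_inv g)).
Proof.
by move=> gE x; rewrite /iso_act /= mulmxDl -mulmxA gE mulmx1 addrK.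
Qed.

Lemma iso_invVK g : isE2 g -> cancel (iso_act (iso_inv g)) (iso_act g).
Proof.
move=> gE x; rewrite /iso_act /= mulmxDl mulNmx -!mulmxA (mulmx1C gE) !mulmx1.
by rewrite subrK.
Qed.

Lemma isE2_mul g h : isE2 g -> isE2 h -> isE2 (iso_mul g h).
Proof.
by rewrite /isE2 /= => gE hE; rewrite trmx_mul mulmxA -(mulmxA g.1) hE mulmx1.
Qed.

Lemma isE2_one : isE2 (iso_one R).
Proof. by rewrite /isE2 /= trmx1 mulmx1. Qed.

Lemma isE2_inv g : isE2 g -> isE2 (iso_inv g).
Proof. by rewrite /isE2 /= trmxK => /mulmx1C. Qed.

Lemma det_mx22 (M : 'M[R]_2) : \det M = M 0 0 * M 1 1 - M 0 1 * M 1 0.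
Proof.
rewrite (expand_det_row _ ord0) !big_ord_recl big_ord0 addr0.
rewrite /cofactor !det_mx11 !mxE /= expr0 mul1r expr1 mulN1r mulrN.
by congr (M _ _ * M _ _ - M _ _ * M _ _); apply: val_inj.
Qed.

Local Notation C := R[i].

Definition zeta x : C := (x 0 0 +i* x 0 1)%C.

Lemma zetaB x y : zeta (x - y) = zeta x - zeta y.
Proof. by rewrite /zeta !mxE. Qed.

Lemma zeta_inj : injective zeta.
Proof.
move=> x y [E0 E1]; apply/rowP => -[[|[|//]] H].
  by move: E0; congr (x _ _ = y _ _); apply: val_inj.
by move: E1; congr (x _ _ = y _ _); apply: val_inj.
Qed.

Lemma dotE x y : dot x y = x 0 0 * y 0 0 + x 0 1 * y 0 1.
Proof.
rewrite /dot mxE !big_ord_recl big_ord0 addr0 !mxE.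
by congr (x _ _ * y _ _ + x _ _ * y _ _); apply: val_inj.
Qed.

Lemma dot_zeta x : (dot x x)%:C%C = zeta x * (zeta x)^*%C.
Proof. by rewrite dotE; apply/eqP; rewrite eq_complex /=; apply/andP; split; apply/eqP; ring. Qed.

Lemma dot_eq0 x : (dot x x == 0) = (x == 0).
Proof.
have z0 : zeta 0 = 0 by rewrite /zeta !mxE.
rewrite -(inj_eq (@complexI R)) dot_zeta mulf_eq0 conjc_eq0 orbb.
by rewrite -z0 (inj_eq zeta_inj).
Qed.

Lemma dist_zeta P Q : (dist P Q)%:C%C ^+ 2 = (zeta P - zeta Q) * (zeta P - zeta Q)^*%C.
Proof.
rewrite -zetaB -dot_zeta -rmorphXn /= /dist sqr_sqrtr // dotE.
by rewrite addr_ge0 // -expr2 sqr_ge0.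
Qed.

(** With s = d.d, the matrix d^T d is symmetric with square s d^T d, so the linear part is a
    symmetric involution. *)
Lemma refl_E2 P Q : P != Q -> isE2 (refl P Q).
Proof.
rewrite -subr_eq0 -oppr_eq0 opprB /isE2 /refl /=; set d := Q - P => d0.
have s0 : dot d d != 0 by rewrite dot_eq0.
have dd : d *m d^T = (dot d d)%:M by rewrite [LHS]mx11_scalar.
set B := d^T *m d.
have BB : B *m B = dot d d *: B.
  by rewrite {1}/B -mulmxA (mulmxA d) dd mul_scalar_mx -scalemxAr.
have BT : B^T = B by rewrite /B trmx_mul trmxK.
rewrite linearB linearZ /= trmx1 BT mulmxBr mulmxBl mulmx1 mul1mx.
rewrite -scalemxAl -scalemxAr BB !scalerA.
have -> : 2 / dot d d * (2 / dot d d) * dot d d = 2 / dot d d + 2 / dot d d.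
  by field.
by rewrite scalerDl addrK opprB addrC subrK.
Qed.

Lemma zetaD x y : zeta (x + y) = zeta x + zeta y.
Proof. by rewrite /zeta !mxE. Qed.

Lemma zetaZ (k : R) x : zeta (k *: x) = k%:C%C * zeta x.
Proof. by rewrite /zeta !mxE; apply/eqP; rewrite eq_complex /= !mul0r subr0 addr0 !eqxx. Qed.

Lemma zeta_dot x y :
  (2 * dot x y)%:C%C = zeta x * (zeta y)^*%C + (zeta x)^*%C * zeta y.
Proof. by rewrite dotE; apply/eqP; rewrite eq_complex /=; apply/andP; split; apply/eqP; ring. Qed.

Lemma zeta_eq0 x : (zeta x == 0) = (x == 0).
Proof. by rewrite -[RHS]dot_eq0 -(inj_eq (@complexI R)) dot_zeta mulf_eq0 conjc_eq0 orbb. Qed.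

(** For w = x - P and d = Q - P as complex numbers, twice the dot product is w conj d + d conj w.
    Multiplying by d / (d conj d) and subtracting w leaves (d / conj d) conj w. *)
Lemma zeta_refl P Q x : P != Q ->
  zeta (iso_act (refl P Q) x) =
  zeta P + (zeta Q - zeta P) / (zeta Q - zeta P)^*%C * (zeta x - zeta P)^*%C.
Proof.
move=> PQ; rewrite -!zetaB.
have d0 : zeta (Q - P) != 0 by rewrite zeta_eq0 subr_eq0 eq_sym.
have -> : iso_act (refl P Q) x =
    P + ((2 * dot (x - P) (Q - P)) / dot (Q - P) (Q - P)) *: (Q - P) - (x - P).
  rewrite /iso_act /refl /=; set d := Q - P; set c := 2 / _.
  have E y : y *m (c *: (d^T *m d) - 1%:M) = (c * dot y d) *: d - y.
    by rewrite mulmxBr mulmx1 -scalemxAr mulmxA [y *m d^T]mx11_scalar mul_scalar_mx scalerA.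
  rewrite addrCA -mulmxBl E addrA; congr (P + _ *: _ - _).
  by rewrite /c mulrAC.
have E (k m : R) : (k / m)%:C%C = k%:C%C / m%:C%C by exact: fmorph_div.
rewrite zetaB zetaD zetaZ E zeta_dot dot_zeta.
have d1 : (zeta (Q - P))^*%C != 0 by rewrite conjc_eq0.
move: (zeta P) (zeta (Q - P)) (zeta (Q - P))^*%C (zeta (x - P)) (zeta (x - P))^*%C d0 d1.
by move=> p d d' y y' d0 d1; field; rewrite d0 d1.
Qed.

Lemma refl_involutive P Q : P != Q -> involutive (iso_act (refl P Q)).
Proof.
move=> PQ x; apply: zeta_inj; rewrite !zeta_refl // addrAC subrr add0r.
have d0 : zeta Q - zeta P != 0 by rewrite -zetaB zeta_eq0 subr_eq0 eq_sym.
have E (u v w : C) : ((u / v^*%C) * w^*%C)^*%C = u^*%C / v * w.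
  by rewrite rmorphM fmorph_div /= !conjcK.
rewrite E.
have d1 : (zeta Q - zeta P)^*%C != 0 by rewrite conjc_eq0.
move: (zeta Q - zeta P) (zeta Q - zeta P)^*%C d0 d1 => d d' d0 d1.
by field; rewrite d0 d1.
Qed.

Lemma det_refl P Q : P != Q -> \det (refl P Q).1 = -1.
Proof.
rewrite eq_sym -subr_eq0 -dot_eq0 /refl /=; move: (Q - P) => d s0.
have E i j : ((2 / dot d d) *: (d^T *m d) - 1%:M) i j = 2 / dot d d * (d 0 i * d 0 j) - (i == j)%:R.
  by rewrite 3!mxE big_ord1 3!mxE.
rewrite det_mx22 !E /=; move: s0; rewrite dotE; move: (d 0 0) (d 0 1) => p q s0.
by field.
Qed.
End Isometries.

(** * The triangle group *)

Lemma det_col_mx2 (R : realType) (u v : 'rV[R]_2) :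
  \det (col_mx u v) = u 0 0 * v 0 1 - u 0 1 * v 0 0.
Proof.
have E0 j : col_mx u v (0 : 'I_2) j = u 0 j.
  by rewrite -(col_mxEu u v 0 j); congr (col_mx _ _ _ _); apply: val_inj.
have E1 j : col_mx u v (1 : 'I_2) j = v 0 j.
  by rewrite -(col_mxEd u v 0 j); congr (col_mx _ _ _ _); apply: val_inj.
by rewrite (@det_mx22 R (col_mx u v)) !E0 !E1.
Qed.

Section Triangle.
Variables (R : realType) (A1 A2 A3 : point R).
Hypothesis nc : noncollinear A1 A2 A3.
Hypothesis gen : generic_lengths (dist A2 A3) (dist A3 A1) (dist A1 A2).
Local Notation C := R[i].
Local Notation p2 := (zeta A2).
Local Notation p3 := (zeta A3).

Let d1 : C := zeta A3 - zeta A2.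
Let d2 : C := zeta A1 - zeta A3.
Let d3 : C := zeta A2 - zeta A1.

(** The factor of r1 r2, a rotation about A3; [rot2] is that of r1 r3, about A2. Each is (e / conj
    e) / (d / conj d) for the two edges d, e reflected in. *)
Definition rot3 : C := (d2 * d1^*%C) / (d2^*%C * d1).
Definition rot2 : C := (d3 * d1^*%C) / (d3^*%C * d1).
Local Notation x := rot3.
Local Notation y := rot2.

Let d3E : d3 = - d1 - d2.
Proof. by rewrite /d1 /d2 /d3; ring. Qed.

Lemma area_neq0 : complex.Im (d2 * d1^*%C) != 0.
Proof.
move: nc; rewrite /noncollinear det_col_mx2; congr (_ != 0).
by rewrite /d1 /d2 -!zetaB /zeta !mxE /=; ring.
Qed.

Let d1_neq0 : d1 != 0.
Proof. by apply: contraNneq area_neq0 => ->; rewrite rmorph0 mulr0. Qed.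
Let d2_neq0 : d2 != 0.
Proof. by apply: contraNneq area_neq0 => ->; rewrite mul0r. Qed.
Let d3_neq0 : d3 != 0.
Proof.
apply: contraNneq area_neq0 => E.
have -> : d2 = - d1 by apply/eqP; rewrite -subr_eq0 opprK addrC -oppr_eq0 opprD -d3E E.
by rewrite mulNr /=; apply/eqP; ring.
Qed.

Lemma A1_neq_A2 : A1 != A2. Proof. by move: d3_neq0; rewrite /d3 -zetaB zeta_eq0 subr_eq0 eq_sym. Qed.
Lemma A2_neq_A3 : A2 != A3. Proof. by move: d1_neq0; rewrite /d1 -zetaB zeta_eq0 subr_eq0 eq_sym. Qed.
Lemma A3_neq_A1 : A3 != A1. Proof. by move: d2_neq0; rewrite /d2 -zetaB zeta_eq0 subr_eq0 eq_sym. Qed.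

(** The law of cosines makes x and y quotients of values of [cosl] at the scaled lengths, where
    [balanced_of_generic] applies. *)
Lemma rot_independent L : laurent L x y = 0 -> balanced L.
Proof.
have [k [k0 ind]] := gen; have [N bL] := boundedP L => L0.
pose t := 2 * k ^+ 2 * complex.Im (d2 * d1^*%C).
have t0 : t != 0 by rewrite !mulf_neq0 ?expf_neq0 ?area_neq0 ?pnatr_eq0 ?gt_eqF.
pose K : C := k%:C%C ^+ 2.
have K0 : K != 0 by rewrite expf_neq0 // fmorph_eq0 gt_eqF.
have tE : (0 +i* t)%C = K * (d2 * d1^*%C - d2^*%C * d1).
  have cM (u v : C) : u^*%C * v = (u * v^*%C)^*%C by rewrite rmorphM /= conjcK.
  rewrite cM.
  rewrite subcJ /t /K; move: (complex.Im _) => m.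
  by apply/eqP; rewrite eq_complex /=; apply/andP; split; apply/eqP; ring.
have lE (P Q : point R) : (k * dist P Q)%:C%C ^+ 2 = K * ((zeta P - zeta Q) * (zeta P - zeta Q)^*%C).
  by rewrite -dist_zeta rmorphM exprMn.
have l1 := lE A2 A3; have l2 := lE A3 A1; have l3 := lE A1 A2.
rewrite -[zeta A2 - _]opprB -/d1 in l1; rewrite -[zeta A3 - _]opprB -/d2 in l2.
rewrite -[zeta A1 - _]opprB -/d3 d3E in l3.
have d3c : d3^*%C = - d1^*%C - d2^*%C by rewrite d3E rmorphB rmorphN.
have cN (u : C) : (- u)^*%C = - u^*%C by rewrite rmorphN.
have cB (u v : C) : (u - v)^*%C = u^*%C - v^*%C by rewrite rmorphB.
rewrite [(- d1)^*%C]cN in l1; rewrite [(- d2)^*%C]cN in l2.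
rewrite [(- (- d1 - d2))^*%C]cN [(- d1 - d2)^*%C]cB [(- d1)^*%C]cN in l3.
move: L0; rewrite /x /y d3c d3E.
have e1 : d1^*%C != 0 by rewrite conjc_eq0.
have e2 : d2^*%C != 0 by rewrite conjc_eq0.
have f3 : - d1 - d2 != 0 by rewrite -d3E.
have e3 : - d1^*%C - d2^*%C != 0 by rewrite -d3c conjc_eq0.
have two0 : (2 : C) != 0 by rewrite pnatr_eq0.
move: (d1) (d2) d1^*%C d2^*%C d1_neq0 d2_neq0 tE l1 l2 l3 e1 e2 f3 e3 {d3c} => a1 a2 b1 b2.
move=> a10 a20 tE l1 l2 l3 e1 e2 f3 e3 L0.
clear lE; clearbody K.
apply: (balanced_of_generic ind t0 _ bL); rewrite tE /heron /cosl !l1 !l2 !l3.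
  by ring.
(* The second angle takes d with the opposite sign: as d3 = - d1 - d2, the products d3 conj d1 and
   d2 conj d1 have opposite imaginary parts. *)
pose P := 2 * K * (a2 * b1); pose P' := 2 * K * (b2 * a1).
pose Q := 2 * K * ((- a1 - a2) * b1); pose Q' := 2 * K * ((- b1 - b2) * a1).
rewrite (eq_bigr (term N P P' Q Q')); last first.
  by move=> s _; congr (term N _ _ _ _ _); rewrite /P /P' /Q /Q'; ring.
rewrite (laurent_term bL) ?mulf_neq0 //.
have -> : P / P' = a2 * b1 / (b2 * a1) by rewrite /P /P'; field; rewrite K0 a10 e2.
have -> : Q / Q' = (- a1 - a2) * b1 / ((- b1 - b2) * a1).
  by rewrite /Q /Q'; field; rewrite K0 e3 a10.
by rewrite L0 mulr0.
Qed.

Definition rotC (i : 'I_2) (z : C) : C :=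
  if i == ord0 then p3 + x * (z - p3) else p2 + y * (z - p2).
Definition rotCV (i : 'I_2) (z : C) : C :=
  if i == ord0 then p3 + x^-1 * (z - p3) else p2 + y^-1 * (z - p2).

Lemma rot3_neq0 : x != 0.
Proof. by rewrite /rot3 !mulf_neq0 ?invr_eq0 ?mulf_neq0 ?conjc_eq0. Qed.

Lemma rot2_neq0 : y != 0.
Proof. by rewrite /rot2 !mulf_neq0 ?invr_eq0 ?mulf_neq0 ?conjc_eq0. Qed.

Lemma rotCK i : cancel (rotC i) (rotCV i).
Proof.
have E (c q z : C) : c != 0 -> q + c^-1 * (q + c * (z - q) - q) = z by move=> ?; field.
by move=> z; rewrite /rotC /rotCV; case: (i == ord0); rewrite E ?rot3_neq0 ?rot2_neq0.
Qed.

Lemma rotCVK i : cancel (rotCV i) (rotC i).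
Proof.
have E (c q z : C) : c != 0 -> q + c * (q + c^-1 * (z - q) - q) = z by move=> ?; field.
by move=> z; rewrite /rotC /rotCV; case: (i == ord0); rewrite E ?rot3_neq0 ?rot2_neq0.
Qed.

Lemma rot2_neq1 : y != 1.
Proof.
apply/negP => /eqP y1.
have bal : balanced [:: ((0, 1), false); ((0, 0), true)].
  apply: rot_independent; rewrite /laurent !big_cons big_nil /= y1 !exp1rz !expr0z.
  by ring.
by have := bal (0, 1).
Qed.

(** The first letter fixes p3; the second moves it by (p2 - p3)(1 - y), which the suffix multiplies
    by its monomial. For an inverse letter, 1 - y^-1 = - y^-1 (1 - y) gives the sign and the shift
    in [fox]. *)
Lemma act_rotC w z : act rotC rotCV w z - p3 =
  x ^ expsum ord0 w * y ^ expsum ord_max w * (z - p3)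
  + (p2 - p3) * (1 - y) * laurent (fox w) x y.
Proof.
elim: w z => [|[i e] w IH] z.
  by rewrite /laurent /expsum !big_nil !expr0z mulr0 addr0 !mul1r.
rewrite [act _ _ _ _]/= IH !expsum_cons /=.
have [x0 y0] := (rot3_neq0, rot2_neq0).
have [->|->] := ord2P i => /=.
  rewrite add0r expfzDr //; congr (_ + _).
  have -> : (if e then rotCV else rotC) ord0 z - p3 = x ^ ((-1) ^+ e) * (z - p3).
    by case: e; rewrite /rotC /rotCV /= addrAC subrr add0r.
  move: (x ^ ((-1) ^+ e)) (x ^ _) (y ^ _) (z - p3) => a b c d.
  by ring.
rewrite add0r /laurent big_cons -/(laurent _ _ _) /= !expfzDr //.
move: (laurent _ _ _) (x ^ _) (y ^ expsum _ _) => l X Y.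
case: e; rewrite /rotC /rotCV /=.
  have -> : y ^ ((-1) ^+ 1%N) = y^-1 by [].
  move: y0; move: y p2 p3 => c q q' c0.
  by field.
have -> : y ^ ((-1) ^+ 0%N) = y by [].
have -> : y ^ (- 0%Z) = 1 by [].
move: y p2 p3 => c q q'.
by ring.
Qed.

(** Fixing p3 makes the Fox derivative vanish; fixing p2 as well gives x^m y^n = 1 for the exponent
    sums m, n. *)
Lemma fox_faithful w : act rotC rotCV w p3 = p3 -> act rotC rotCV w p2 = p2 -> derived2 w.
Proof.
move=> w3 w2; have := act_rotC w p3; have := act_rotC w p2.
have q0 : p2 - p3 != 0 by rewrite -oppr_eq0 opprB d1_neq0.
have y1 : 1 - y != 0 by rewrite subr_eq0 eq_sym rot2_neq1.
rewrite w3 w2 subrr mulr0 add0r => E2 /esym/eqP.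
rewrite !mulf_eq0 (negPf q0) (negPf y1) /= => /eqP l0.
move: E2; rewrite l0 mulr0 addr0 -{1}[p2 - p3]mul1r => /(mulIf q0)/esym E.
(* The relation x^m y^n - 1 = 0 is balanced only if m = n = 0. *)
have := @rot_independent [:: ((expsum ord0 w, expsum ord_max w), false); ((0, 0), true)].
rewrite {1}/laurent !big_cons big_nil /= -mulrA mul1r E !expr0z.
rewrite mulr1 mulr1 addr0 addrN => /(_ erefl) /(_ (0, 0)).
rewrite /= !xpair_eqE /= !andbF !andbT /= !add0n => /eqP.
have [m0|] := eqVneq (expsum ord0 w) 0 => //; have [n0|] := eqVneq (expsum ord_max w) 0 => // _.
by apply: derived2_fox => //; apply: rot_independent.
Qed.

(** Exponent sums vanish on F', so its elements act by translations, which commute. *)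
Lemma act_derived2 w : derived2 w -> act rotC rotCV w =1 id.
Proof.
apply: (act_gen_sub rotCK rotCVK) => _ [u [v [Hu Hv ->]]] z.
have tr t : derived1 t -> exists c, forall z, act rotC rotCV t z = z + c.
  move=> Ht; exists ((p2 - p3) * (1 - y) * laurent (fox t) x y) => z'.
  have := act_rotC t z'; rewrite !expsum_derived1 // !expr0z !mul1r => E.
  by rewrite -[LHS](subrK p3) E addrAC subrK.
have trV t c : (forall z, act rotC rotCV t z = z + c) -> forall z, act rotC rotCV (winv t) z = z - c.
  by move=> E z'; rewrite -{1}[z'](subrK c) -E (actK rotCK rotCVK).
have [cu Eu] := tr u Hu; have [cv Ev] := tr v Hv.
rewrite /wcomm !act_cat (trV _ _ Eu) (trV _ _ Ev) Eu Ev.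
by ring.
Qed.

Definition tri_refl (k : 'I_3) : iso R :=
  nth (r1 A1 A2 A3) [:: r1 A1 A2 A3; r2 A1 A2 A3; r3 A1 A2 A3] k.
Local Notation s := (fun k => iso_act (tri_refl k)).

Definition tri_rot (i : 'I_2) : iso R :=
  if i == ord0 then iso_mul (r1 A1 A2 A3) (r2 A1 A2 A3)
  else iso_mul (r1 A1 A2 A3) (r3 A1 A2 A3).

Lemma tri_refl_prop (P : iso R -> Prop) :
  (forall B D, B != D -> P (refl B D)) -> forall k, P (tri_refl k).
Proof.
move=> HP [[|[|[|//]]] H]; rewrite /tri_refl /=; apply: HP;
  [exact: A2_neq_A3 | exact: A3_neq_A1 | exact: A1_neq_A2].
Qed.

Lemma tri_refl_E2 k : isE2 (tri_refl k).
Proof. by apply: (tri_refl_prop (P := @isE2 R)); apply: refl_E2. Qed.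

Lemma tri_refl_involutive k : involutive (s k).
Proof.
by apply: (tri_refl_prop (P := fun g => involutive (iso_act g))); apply: refl_involutive.
Qed.

Lemma det_tri_refl k : \det (tri_refl k).1 = -1.
Proof. by apply: (tri_refl_prop (P := fun g => \det g.1 = -1)); apply: det_refl. Qed.

Lemma tri_refl_inv k v : iso_act (iso_inv (tri_refl k)) v = s k v.
Proof. by rewrite -{1}[v](tri_refl_involutive k) (iso_invK (tri_refl_E2 k)). Qed.

Lemma act_tri_refl w v : iso_act (weval tri_refl w) v = act s s w v.
Proof. by rewrite iso_act_weval; apply: act_ext => // k u; apply: tri_refl_inv. Qed.

Lemma tri_rotE i : tri_rot i = iso_mul (tri_refl ord0) (tri_refl (lift ord0 i)).
Proof. by have [->|->] := ord2P i. Qed.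

Lemma tri_rot_E2 i : isE2 (tri_rot i).
Proof. by rewrite tri_rotE; apply: isE2_mul; apply: tri_refl_E2. Qed.

Lemma weval_E2 (T : Type) (g : T -> iso R) w :
  (forall t, isE2 (g t)) -> isE2 (weval g w).
Proof.
move=> gE; elim: w => [|[t e] w IH] /=; first exact: isE2_one.
by apply: isE2_mul => //; case: e => //; apply: isE2_inv.
Qed.

Lemma act_weval (T : Type) (g : T -> iso R) (h : T -> word 'I_3) w v :
  (forall t, weval tri_refl (h t) = g t) ->
  iso_act (weval g w) v = act s s (wsubst h w) v.
Proof.
move=> Eg; have E t u : iso_act (g t) u = act s s (h t) u by rewrite -Eg act_tri_refl.
have gE t : isE2 (g t).
  by rewrite -Eg; apply: weval_E2; apply: tri_refl_E2.
rewrite iso_act_weval act_subst; apply: act_ext => // t u.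
rewrite -{1}[u](actVK tri_refl_involutive tri_refl_involutive (h t)) -E.
by rewrite iso_invK.
Qed.

Lemma weval_pairw i : weval tri_refl (pairw i) = tri_rot i.
Proof. by apply: iso_act_inj => v; rewrite act_tri_refl tri_rotE iso_act_mul. Qed.

Lemma act_tri_rot w v : iso_act (weval tri_rot w) v = act s s (wsubst pairw w) v.
Proof. exact/act_weval/weval_pairw. Qed.

Lemma zeta_tri_rot i v : zeta (iso_act (tri_rot i) v) = rotC i (zeta v).
Proof.
(* A reflection may be based at either endpoint of its edge, so both factors are based at their
   common vertex. *)
have base (p q z : C) : q - p != 0 ->
    p + (q - p) / (q - p)^*%C * (z - p)^*%C = q + (q - p) / (q - p)^*%C * (z - q)^*%C.
  move=> d0; have -> : z - p = (z - q) + (q - p) by ring.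
  have cD (u u' : C) : (u + u')^*%C = u^*%C + u'^*%C by rewrite rmorphD.
  rewrite (cD (z - q)); have: (q - p)^*%C != 0 by rewrite conjc_eq0.
  by move: (q - p)^*%C (z - q)^*%C => c c' c0; field.
have comp (p d e z : C) : d != 0 -> e != 0 ->
    p + e / e^*%C * (p + d / d^*%C * (z - p)^*%C - p)^*%C =
    p + (e * d^*%C) / (e^*%C * d) * (z - p).
  move=> d0 e0; rewrite [p + _ - _]addrAC subrr add0r rmorphM fmorph_div /= !conjcK.
  have: e^*%C != 0 by rewrite conjc_eq0.
  by move: e^*%C d^*%C => e' d' e'0; field; rewrite d0 e'0.
rewrite /tri_rot /rotC; case: ifP => _; rewrite iso_act_mul /r1 /r2 /r3.
  by rewrite !zeta_refl ?A2_neq_A3 ?A3_neq_A1 // (base p2 p3) // comp.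
by rewrite !zeta_refl ?A2_neq_A3 ?A1_neq_A2 // (base (zeta A1) p2) // comp.
Qed.

Lemma zeta_weval w v : zeta (iso_act (weval tri_rot w) v) = act rotC rotCV w (zeta v).
Proof.
rewrite iso_act_weval; apply: act_morph => i u; first exact: zeta_tri_rot.
by rewrite -{2}[u](iso_invVK (tri_rot_E2 i)) zeta_tri_rot rotCK.
Qed.

Lemma weval_tri_rot_eq1 w : weval tri_rot w = iso_one R <-> derived2 w.
Proof.
split=> [E|/act_derived2 E]; last first.
  by apply: iso_act_inj => v; apply: zeta_inj; rewrite zeta_weval E iso_act_one.
by apply: fox_faithful; rewrite -zeta_weval E iso_act_one.
Qed.

Lemma det_weval_tri_rot w : \det (weval tri_rot w).1 = 1.
Proof.
have det_rot i : \det (tri_rot i).1 = 1.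
  by rewrite tri_rotE [LHS]det_mulmx !det_tri_refl mulrNN mulr1.
elim: w => [|[t e] w IH]; first exact: det1.
by rewrite [LHS]det_mulmx IH mulr1; case: e => /=; rewrite ?det_tr det_rot.
Qed.

Lemma G_tau_tri_refl k : G_tau A1 A2 A3 (tri_refl k).
Proof.
apply: gi_base; case: k => [[|[|[|//]]] H];
  by [constructor 1 | constructor 2 | constructor 3].
Qed.

Lemma H_tau_weval w : H_tau A1 A2 A3 (weval tri_rot w).
Proof.
split; last by split; [apply: weval_E2; apply: tri_rot_E2 | apply: det_weval_tri_rot].
elim: w => [|[t e] w IH] /=; first exact: gi_one.
have Gt : G_tau A1 A2 A3 (tri_rot t).
  by rewrite tri_rotE; apply: gi_mul; apply: G_tau_tri_refl.
by apply: gi_mul => //; case: e => //; apply: gi_inv.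
Qed.

Lemma G_tau_word h : G_tau A1 A2 A3 h -> exists w, weval tri_refl w = h.
Proof.
elim=> {h} [h H||g h _ [u Eu] _ [v Ev]|g _ [u Eu]].
- have [k ->] : exists k, h = tri_refl k.
    by case: H => ->; [exists (inord 0) | exists (inord 1) | exists (inord 2)];
      rewrite /tri_refl inordK.
  exists [:: (k, false)]; apply: iso_act_inj => v; by rewrite act_tri_refl.
- by exists [::].
- exists (u ++ v); apply: iso_act_inj => p.
  by rewrite act_tri_refl act_cat iso_act_mul -Eu -Ev !act_tri_refl.
exists (winv u); apply: iso_act_inj => p; rewrite act_tri_refl.
have gE : isE2 g by rewrite -Eu; apply: weval_E2; apply: tri_refl_E2.
rewrite -{1}[p](iso_invVK gE) -{1}Eu act_tri_refl.
by rewrite (actK tri_refl_involutive tri_refl_involutive).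
Qed.

(** A leftover reflection in [even_form] would make the determinant -1. *)
Lemma det1_even_form w : \det (weval tri_refl w).1 = 1 ->
  exists u, forall (X : Type) (t : 'I_3 -> X -> X), (forall k, involutive (t k)) ->
  act t t w =1 act t t (wsubst pairw u).
Proof.
move=> detw; have [u [b Eu]] := even_form w; exists u; case: b Eu => Eu; last first.
  by move=> X t tK z; rewrite Eu // cats0.
have E : weval tri_refl w = iso_mul (weval tri_rot u) (tri_refl ord0).
  apply: iso_act_inj => v; rewrite iso_act_mul act_tri_refl.
  by rewrite (Eu _ _ tri_refl_involutive) act_cat act_tri_rot.
move/eqP: detw; rewrite E [\det _]det_mulmx det_weval_tri_rot det_tri_refl mul1r.
by rewrite eq_sym -addr_eq0 (_ : 1 + 1 = 2%:R) ?pnatr_eq0.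
Qed.

Lemma H_tau_word h : H_tau A1 A2 A3 h -> exists w, weval tri_rot w = h.
Proof.
case=> /G_tau_word[w <-] [_ /det1_even_form[u Eu]]; exists u.
by apply: iso_act_inj => v; rewrite act_tri_rot act_tri_refl (Eu _ _ tri_refl_involutive).
Qed.

(** Every relation of G follows from r_k^2 = 1 and from F'' in the rotations; this consequence is
    expressed through actions of arbitrary involutions. *)
Lemma tri_refl_kernel w : weval tri_refl w = iso_one R ->
  exists2 u, derived2 u & forall (X : Type) (t : 'I_3 -> X -> X),
    (forall k, involutive (t k)) -> act t t w =1 act t t (wsubst pairw u).
Proof.
move=> Ew; have [|u Eu] := @det1_even_form w; first by rewrite Ew det1.
exists u => //; apply/weval_tri_rot_eq1; apply: iso_act_inj => v.
by rewrite act_tri_rot -(Eu _ _ tri_refl_involutive) -act_tri_refl Ew.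
Qed.

End Triangle.

(** * Failure of finite presentability *)

Section Lamps.
Variable M : nat.
Hypothesis M1 : (1 < M)%N.
Implicit Types (x : int * option bool) (j : int) (k : option bool).

Definition swap (e : bool) k : option bool :=
  if k is Some e' then if e == e' then None else k else Some e.

(* The lamps at 0 and M act by two noncommuting transpositions of the three
   states, so the conjugates of [lamp] by translations t and t' commute unless
   t - t' = M or -M. *)
Definition lamp x : int * option bool :=
  (x.1, if x.1 == 0 then swap false x.2
        else if x.1 == M%:Z then swap true x.2 else x.2).

Arguments lamp : simpl never.

(** Exchanging both the positions 0 and M and the two transpositions makes it commute with
    [lamp]. *)
Definition flip x : int * option bool := (M%:Z - x.1, omap negb x.2).

(** Chosen so that the first times the second is the unit translation and the first times the third
    is [lamp]. *)
Definition lamp_refl (i : 'I_3) x : int * option bool :=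
  let y := flip x in
  match val i with 0%N => y | 1%N => (y.1 + 1, y.2) | _ => lamp y end.

Lemma swapK e : involutive (swap e).
Proof. by case: e => -[[]|]. Qed.

Lemma lampK : involutive lamp.
Proof.
by move=> [j k]; rewrite /lamp /=; case: (j == 0); case: (j == M%:Z); rewrite ?swapK.
Qed.

Lemma flipK : involutive flip.
Proof. by move=> [j [[]|]]; rewrite /flip /= opprB addrC subrK. Qed.

Lemma flip_lamp x : flip (lamp x) = lamp (flip x).
Proof.
case: x => j k; rewrite /lamp /flip /=; congr (_, _).
case: eqP => [->|j0].
  rewrite subr0 eqxx; case: eqP => [|_]; first by lia.
  by case: k => [[]|].
case: eqP => [->|jM]; first by rewrite subrr eqxx; case: k => [[]|].
by case: eqP => [|_]; [lia | case: eqP => [|//]; lia].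
Qed.

Lemma lamp_reflK i : involutive (lamp_refl i).
Proof.
move=> x; case: i => [[|[|[|//]]] H]; rewrite /lamp_refl /=.
- exact: flipK.
- case: x => j k; rewrite -[RHS]flipK /flip /=; congr (_, _); lia.
- by rewrite flip_lamp lampK flipK.
Qed.

Local Notation lact := (act lamp_refl lamp_refl).

Definition step (i : 'I_2) x := if i == ord0 then (x.1 + 1, x.2) else lamp x.
Definition stepV (i : 'I_2) x := if i == ord0 then (x.1 - 1, x.2) else lamp x.
Local Notation act2 := (act step stepV).

Lemma lamp_pairw u x : lact (wsubst pairw u) x = act2 u x.
Proof.
rewrite act_subst; apply: act_ext => i {}x.
  have [->|->] := ord2P i; rewrite /= /lamp_refl /step /=; last by rewrite flipK.
  by case: x => j [[]|]; rewrite /flip /=; congr (_, _); lia.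
have [->|->] := ord2P i; rewrite /= /lamp_refl /step /stepV /=.
  by case: x => j [[]|]; rewrite /flip /=; congr (_, _); lia.
by rewrite flip_lamp flipK.
Qed.

(** The position moves by at most the length of the word, so one of the two lamps is never met and
    only the transposition of the other acts. *)
Lemma act2_swap (e : bool) u j :
  (if e then (size u)%:Z < j else j + (size u)%:Z < M%:Z) ->
  exists b : bool, forall k,
    act2 u (j, k) = (j + expsum ord0 u, if b then swap e k else k).
Proof.
elim: u j => [|[i c] u IH] j Hj; first by exists false => k; rewrite /expsum big_nil addr0.
rewrite expsum_cons /=; have [->|->] := ord2P i => /=.
  have [|b Hb] := IH (j + (-1) ^+ c).
    by move: Hj => /=; case: (e); case: (c) => /=; rewrite ?expr0 ?expr1; lia.
  exists b => k; rewrite addrA -Hb /step /stepV.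
  by case: (c).
have [|b Hb] := IH j; first by move: Hj => /=; case: (e); lia.
have [b' Hb'] : exists b' : bool, forall k, lamp (j, k) = (j, if b' then swap e k else k).
  rewrite /lamp /=; case: (e) Hj => /= Hj.
    exists (j == M%:Z) => k; case: eqP => [j0|_]; first by lia.
    by case: eqP.
  exists (j == 0) => k; case: eqP => // _; case: eqP => [jM|//]; lia.
exists (b (+) b') => k; rewrite add0r.
have -> : (if c then stepV else step) ord_max (j, k) = lamp (j, k) by case: (c).
by rewrite Hb' Hb; case: (b); case: (b') => //=; rewrite swapK.
Qed.

Lemma stepK i : cancel (step i) (stepV i).
Proof.
by move=> [j k]; rewrite /step /stepV; case: (i == ord0); [rewrite /= addrK | apply: lampK].
Qed.

Lemma stepVK i : cancel (stepV i) (step i).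
Proof.
by move=> [j k]; rewrite /step /stepV; case: (i == ord0); [rewrite /= subrK | apply: lampK].
Qed.

Lemma act2_comm u v x : derived1 u -> derived1 v ->
  (2 * (size u + size v) < M)%N -> act2 (wcomm u v) x = x.
Proof.
move=> Hu Hv szM; case: x => j k.
(* If j <= |u| + |v|, the bound on M keeps both words below position M; otherwise both stay above
   0. *)
pose e := (size u + size v)%:Z < j.
have He w : (size w <= size u + size v)%N ->
    if e then (size w)%:Z < j else j + (size w)%:Z < M%:Z.
  by rewrite /e; case: ifP; lia.
have [|bu Eu] := @act2_swap e u j; first by apply: He; lia.
have [|bv Ev] := @act2_swap e v j; first by apply: He; lia.
rewrite !expsum_derived1 // addr0 in Eu Ev.
have inv w (b : bool) : (forall k, act2 w (j, k) = (j, if b then swap e k else k)) ->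
    forall k, act2 (winv w) (j, k) = (j, if b then swap e k else k).
  move=> E k'; have {1}-> : (j, k') = act2 w (j, if b then swap e k' else k').
    by rewrite E; case: (b); rewrite ?swapK.
  by rewrite (actK stepK stepVK).
rewrite /wcomm !act_cat (inv _ _ Eu) (inv _ _ Ev) Eu Ev.
by case: (bu); case: (bv); rewrite ?swapK.
Qed.

Lemma act2_nseq n (c : bool) x :
  act2 (nseq n (ord0, c)) x = (x.1 + n%:Z * (-1) ^+ c, x.2).
Proof.
elim: n x => [|n IH] [j k] /=; first by rewrite mul0r addr0.
have -> : (if c then stepV else step) ord0 (j, k) = (j + (-1) ^+ c, k) by case: c {IH}.
by rewrite IH; congr (_, _) => /=; lia.
Qed.

Definition far_comm : word 'I_2 :=
  let a := [:: (ord0, false)] in let b := [:: (ord_max, false)] in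
  let p := nseq M (ord0, false) in
  wcomm (wcomm a b) (wcomm a (p ++ b ++ winv p)).

Lemma far_comm_derived2 : derived2 far_comm.
Proof. by apply: gs_base; do 2!eexists; split; last reflexivity; apply: gs_base; do 2!eexists. Qed.

(** At position 0 the inner commutators act by the transpositions of the lamps at 0 and M, whose
    commutator is a 3-cycle. *)
Lemma far_comm_act : act2 far_comm (0, None) <> (0, None).
Proof.
have winv_nseq n : winv (nseq n (ord0 : 'I_2, false)) = nseq n (ord0, true).
  by rewrite /winv map_nseq rev_nseq.
have stepE (c : bool) x : act2 [:: (ord0, c)] x = (x.1 + (-1) ^+ c, x.2) by case: c.
have lampE (c : bool) x : act2 [:: (ord_max, c)] x = lamp x by case: c.
have winv1 (i : 'I_2) : winv [:: (i, false)] = [:: (i, true)] by [].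
rewrite /far_comm; set u := wcomm _ [:: _]; set v := wcomm _ (_ ++ _).
have Eu k : act2 u (0, k) = (0, swap false k).
  by rewrite /u /wcomm !winv1 !act_cat !(stepE, lampE).
pose Q c : word 'I_2 := nseq M (ord0, false) ++ [:: (ord_max, c)] ++ nseq M (ord0, true).
have QE c x : act2 (Q c) x = (x.1, (lamp (x.1 + M%:Z, x.2)).2).
  by rewrite /Q !act_cat !(lampE, act2_nseq) /= expr0 mulr1 expr1 mulrN1 addrK.
have vE : v = [:: (ord0, true)] ++ Q true ++ [:: (ord0, false)] ++ Q false.
  by rewrite /v /wcomm !winv_cat winvK winv_nseq !winv1 -!catA.
have Ev k : act2 v (0, k) = (0, swap true k).
  rewrite vE 3!act_cat !QE !stepE /lamp /=; move: M1 => M1'.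
  by do !(case: eqP => ?; try by lia).
clear vE.
have inv w (e : bool) : (forall k, act2 w (0, k) = (0, swap e k)) ->
    forall k, act2 (winv w) (0, k) = (0, swap e k).
  move=> E k; have {1}-> : (0 : int, k) = act2 w (0, swap e k) by rewrite E swapK.
  by rewrite (actK stepK stepVK).
clearbody u v.
by rewrite /wcomm !act_cat (inv _ _ Eu) (inv _ _ Ev) Eu Ev.
Qed.
End Lamps.

(** A derivation of membership in F'' uses finitely many commutators, all covered by [act2_comm] for
    large M. *)
Lemma lamp_kernel u : derived2 u -> exists N, forall M, (N <= M)%N ->
  act (lamp_refl M) (lamp_refl M) (wsubst pairw u) =1 id.
Proof.
move=> Hu; suff [N HN] : exists N, forall M, (N <= M)%N -> (1 < M)%N ->
    act (step M) (stepV M) u =1 id.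
  by exists (maxn N 2) => M; rewrite geq_max => /andP[NM M1] x; rewrite lamp_pairw // HN.
elim: Hu => {u} [_ [u [v [Hu Hv ->]]]||u v _ [N1 H1] _ [N2 H2]|u _ [N H]|u v i e _ [N H]|u v i e _ [N H]].
- by exists (2 * (size u + size v)).+1 => M NM M1 x; apply: act2_comm.
- by exists 0%N.
- exists (maxn N1 N2) => M; rewrite geq_max => /andP[h1 h2] M1 x.
  by rewrite act_cat H1 // H2.
- exists N => M NM M1 x; rewrite -{1}[x](H M NM M1) actK //; [exact: stepK | exact: stepVK].
- exists N => M NM M1 x; rewrite -[RHS](H M NM M1) !act_cat /=.
  by case: (e); rewrite /= ?stepK ?stepVK.
- exists N => M NM M1 x; rewrite -[RHS](H M NM M1) !act_cat /=.
  by case: (e); rewrite /= ?stepK ?stepVK.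
Qed.

Section NotFinitelyPresented.
Variables (R : realType) (A1 A2 A3 : point R).
Hypothesis nc : noncollinear A1 A2 A3.
Hypothesis gen : generic_lengths (dist A2 A3) (dist A3 A1) (dist A1 A2).
Local Notation r := (tri_refl A1 A2 A3).
Local Notation s := (fun k => iso_act (r k)).

Lemma weval_r_kernel_lamp w : weval r w = iso_one R -> exists N, forall M, (N <= M)%N ->
  act (lamp_refl M) (lamp_refl M) w =1 id.
Proof.
move=> /(tri_refl_kernel nc gen)[u /lamp_kernel[N HN] Eu].
exists (maxn N 2) => M; rewrite geq_max => /andP[NM M1] x.
by rewrite Eu ?HN // => k; apply: lamp_reflK.
Qed.

(** [gh] writes the given generators in the reflections and [om] the reflections in the generators.
    For large M the lamps satisfy the relators, hence all relations of G, which [far_comm]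
    contradicts. *)
Lemma G_tau_not_finitely_presented : ~ finitely_presented (G_tau A1 A2 A3).
Proof.
move=> [n [m [g [rels [Gg surj ker]]]]].
have /fin_all_exists[gh Egh] i := G_tau_word nc (Gg i).
have /fin_all_exists[om Eom] k := surj _ (G_tau_tri_refl A1 A2 A3 k).
have gE i : isE2 (g i) by rewrite -Egh; apply: weval_E2; apply: tri_refl_E2.
have actg w v : iso_act (weval g w) v = act s s (wsubst gh w) v by apply: act_weval.
have rels1 j : weval r (wsubst gh (rels j)) = iso_one R.
  apply: iso_act_inj => v; rewrite act_tri_refl // -actg.
  suff -> : weval g (rels j) = iso_one R by [].
  by apply/ker; apply: gs_base; exists [::], j; rewrite cats0.
(* These relations must hold for the lamps too, so that [om] recovers the three involutions from the
   generators. *)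
have om1 k : weval r (wsubst gh (om k) ++ [:: (k, true)]) = iso_one R.
  apply: iso_act_inj => v; rewrite act_tri_refl // act_cat -actg Eom /= iso_act_one.
  exact: tri_refl_involutive.
have /fin_all_exists[N1 HN1] j := weval_r_kernel_lamp (rels1 j).
have /fin_all_exists[N2 HN2] k := weval_r_kernel_lamp (om1 k).
(* Beyond the bounds of all these finitely many relations, and at least 2. *)
pose M := (2 + (\max_j N1 j + \max_k N2 k))%N.
have M1 : (1 < M)%N by [].
have HM1 j : (N1 j <= M)%N by rewrite (leq_trans (leq_bigmax j)) // /M; lia.
have HM2 k : (N2 k <= M)%N by rewrite (leq_trans (leq_bigmax k)) // /M; lia.
pose t := lamp_refl M.
have tK : forall k, involutive (t k) by move=> k; apply: lamp_reflK.
pose F i := act t t (gh i); pose Fi i := act t t (winv (gh i)).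
have FK i : cancel (F i) (Fi i) by apply: actK.
have FiK i : cancel (Fi i) (F i) by apply: actVK.
have Fom k x : act F Fi (om k) x = t k x.
  rewrite -act_subst -[LHS](tK k); congr (t k _).
  by have := HN2 k M (HM2 k) x; rewrite act_cat.
have Fomi k x : act F Fi (winv (om k)) x = t k x.
  by rewrite -{1}[x](tK k) -{1}Fom (actK FK FiK).
pose w := wsubst pairw (far_comm M).
have w'1 : weval g (wsubst om w) = iso_one R.
  apply: iso_act_inj => v; rewrite iso_act_weval act_subst.
  have Gom k u : act (fun i => iso_act (g i)) (fun i => iso_act (iso_inv (g i))) (om k) u = s k u.
    by rewrite -iso_act_weval Eom.
  rewrite (@act_ext _ _ _ _ s s) //; last first.
    move=> k u; rewrite -{1}[u](tri_refl_involutive nc k) -Gom actK // => i.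
      exact: iso_invK.
    exact: iso_invVK.
  rewrite -act_tri_rot //; congr (iso_act _ v).
  by apply/(weval_tri_rot_eq1 nc gen); apply: far_comm_derived2.
(* Triviality in G puts the word in the normal closure of the relators, which act trivially. *)
have : act F Fi (wsubst om w) =1 id.
  move/ker: w'1; apply: (act_gen_sub FK FiK) => _ [u [j ->]] x.
  rewrite !act_cat; have -> y : act F Fi (rels j) y = y by rewrite -act_subst HN1.
  exact: (actVK FK FiK).
move=> /(_ (0, None)); rewrite act_subst (@act_ext _ _ _ _ t t) //.
by rewrite lamp_pairw //; apply: far_comm_act.
Qed.

End NotFinitelyPresented.

(* H_tau is free metabelian of rank 2 on a := r1 r2 (letter 0) and
   b := r1 r3 (letter 1): the homomorphism F_2 -> H_tau sending the free basis
   to (a, b) is onto with kernel [[F_2,F_2],[F_2,F_2]]; and G_tau is not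
   finitely presented. *)
Theorem theorem5p1 (R : realType) (A1 A2 A3 : point R) :
  noncollinear A1 A2 A3 ->
  generic_lengths (dist A2 A3) (dist A3 A1) (dist A1 A2) ->
  let a := iso_mul (r1 A1 A2 A3) (r2 A1 A2 A3) in
  let b := iso_mul (r1 A1 A2 A3) (r3 A1 A2 A3) in
  let f := fun i : 'I_2 => if i == ord0 then a else b in
  [/\ forall h, H_tau A1 A2 A3 h -> exists w : word 'I_2, weval f w = h,
      forall w : word 'I_2, H_tau A1 A2 A3 (weval f w),
      forall w : word 'I_2, weval f w = iso_one R <-> derived2 w
    & ~ finitely_presented (G_tau A1 A2 A3)].
Proof.
move=> nc gen a b f; split.
- exact: H_tau_word.
- exact: H_tau_weval.
- exact: (weval_tri_rot_eq1 nc gen).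
- exact: G_tau_not_finitely_presented.
Qed.
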